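(* Let $k$ be an algebraically closed field of characteristic zero and let $(A,\mathfrak{m},k)$ be an Artinian local $k$-algebra of socle degree $3$ which is level of type $\tau$ and compressed, i.e. its $h$-vector $(1,m,n,\tau)$ satisfies $n=\min\left\{\tau m,\binom{m+1}{2}\right\}$. Then $A$ is graded, that is, $A\simeq G$ as $k$-algebras, where $G=\bigoplus_{j\geqslant 0}\mathfrak{m}^j/\mathfrak{m}^{j+1}$ is the associated graded ring of $A$.
   Context: An Artinian local $k$-algebra $(A,\mathfrak m,k)$ here has residue field $k$. Its socle degree is the integer $s$ with $\mathfrak{m}^s\neq 0$ and $\mathfrak{m}^{s+1}=0$. It is $s$-level of type $\tau$ if $\mathrm{Soc}(A):=0:_A\mathfrak{m}=\mathfrak{m}^s$ and $\dim_k\mathrm{Soc}(A)=\tau$. The Hilbert function of $A$ is $HF_A(j)=\dim_k\mathfrak{m}^j/\mathfrak{m}^{j+1}$, and the $h$-vector of $A$ is $(HF_A(0),HF_A(1),\ldots,HF_A(s))$. A level local algebra is called compressed if it has maximal Hilbert function among level local algebras with the same embedding dimension $m=HF_A(1)$, socle degree and type; for socle degree $3$, with $h$-vector $(1,m,n,\tau)$, this means $n=\min\left\{\tau m,\binom{m+1}{2}\right\}$. *)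

(* Defs.v *)
From HB Require Import structures.
From mathcomp Require Import all_boot all_algebra.
From mathcomp Require Import boolp.

Set Implicit Arguments.
Unset Strict Implicit.
Unset Printing Implicit Defensive.

Import GRing.Theory.
Local Open Scope ring_scope.
Local Open Scope quotient_scope.

Section Ideals.
Variables (k : fieldType) (A : comAlgType k).
Implicit Types (I J U V : {pred A}) (m : idealr A).

(* Unlike [idealr], the unit ideal is allowed. *)
Definition is_ideal I : Prop :=
  0 \in I /\ forall a, {in I &, forall u v, a * u + v \in I}.

Definition artinian : Prop :=
  forall I : nat -> {pred A},
    (forall i, is_ideal (I i)) ->
    (forall i, {subset I i.+1 <= I i}) ->
    exists N, forall i, (N <= i)%N -> I i =i I N.

(* [idealr A] is the type of proper ideals of A. *)
Definition is_maximal m : Prop :=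
  forall J : idealr A, {subset m <= J} -> J =i m.

Definition is_local m : Prop :=
  is_maximal m /\ forall m' : idealr A, is_maximal m' -> m' =i m.

(* The structure map k -> A -> A/m is bijective. *)
Definition has_residue_field_k m : Prop :=
  forall a : A, exists! c : k, a - c%:A \in m.

Definition ideal_prod I J : {pred A} := fun x =>
  `[< exists (r : nat) (a b : 'I_r -> A),
        [/\ forall i, a i \in I, forall i, b i \in J
          & x = \sum_i a i * b i] >].

Fixpoint ideal_exp I (j : nat) : {pred A} :=
  if j is j'.+1 then ideal_prod I (ideal_exp I j') else predT.

Definition socle m : {pred A} := fun x =>
  `[< forall y, y \in m -> x * y = 0 >].

Definition socle_degree m (s : nat) : Prop :=
  ~ (ideal_exp m s =i pred1 0) /\ ideal_exp m s.+1 =i pred1 0.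

(* dim_k (U / V) = d, for subspaces V <= U: the classes of some b_0, ...,
   b_(d-1) in U form a basis of U / V. *)
Definition dim_quot U V (d : nat) : Prop :=
  exists b : 'I_d -> A, (forall i, b i \in U) /\
    forall u, u \in U -> exists! c : 'rV[k]_d, u - \sum_i c 0 i *: b i \in V.

Definition level m (s tau : nat) : Prop :=
  [/\ socle_degree m s, socle m =i ideal_exp m s
    & dim_quot (socle m) (pred1 0) tau].

(* HF_A(j) = d *)
Definition hilbert_function_at m (j d : nat) : Prop :=
  dim_quot (ideal_exp m j) (ideal_exp m j.+1) d.

(* h = (HF_A(0), ..., HF_A(s)), with s the socle degree *)
Definition h_vector m (h : seq nat) : Prop :=
  exists s, [/\ socle_degree m s, size h = s.+1
    & forall j, (j <= s)%N -> hilbert_function_at m j (nth 0%N h j)].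

End Ideals.

Section IdealPowers.
Variables (k : fieldType) (A : comAlgType k) (m : idealr A).

Lemma ideal_expP j : is_ideal (ideal_exp m j).
Proof.
elim: j => [|j [IH0 IH]]; first by split.
split.
  apply/asboolP; exists 0%N, (fun=> 0), (fun=> 0); split; try by case.
  by rewrite big_ord0.
move=> c u v /asboolP[r [a [b [ha hb ->]]]] /asboolP[q [a' [b' [ha' hb' ->]]]].
apply/asboolP; exists (r + q)%N.
exists (fun i => match split i with inl i => a i | inr i => a' i end).
exists (fun i => match split i with inl i => c * b i | inr i => b' i end).
split.
- by move=> i; case: split.
- by move=> i; case: split => // i'; rewrite -[_ * _]addr0 IH.
rewrite big_split_ord /= mulr_sumr; congr (_ + _); apply: eq_bigr => i _.
  by rewrite (unsplitK (inl i)) mulrCA.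
by rewrite (unsplitK (inr i)).
Qed.

Lemma ideal_exp0 j : 0 \in ideal_exp m j.
Proof. by case: (ideal_expP j). Qed.

Lemma ideal_expD j : {in ideal_exp m j &, forall u v, u + v \in ideal_exp m j}.
Proof.
by move=> u v hu hv; case: (ideal_expP j) => _ /(_ 1 _ _ hu hv); rewrite mul1r.
Qed.

Lemma ideal_expMl j a : {in ideal_exp m j, forall u, a * u \in ideal_exp m j}.
Proof.
move=> u hu; case: (ideal_expP j) => h0 /(_ a _ _ hu h0).
by rewrite addr0.
Qed.

Lemma ideal_exp_sum j (T : Type) (s : seq T) (P : pred T) (F : T -> A) :
  (forall i, P i -> F i \in ideal_exp m j) ->
  \sum_(i <- s | P i) F i \in ideal_exp m j.
Proof.
move=> h; apply: (big_ind (fun x => x \in ideal_exp m j)) => //.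
  exact: ideal_exp0.
exact: ideal_expD.
Qed.

Lemma ideal_exp_mul i j :
  {in ideal_exp m i & ideal_exp m j, forall u v, u * v \in ideal_exp m (i + j)}.
Proof.
elim: i => [|i IH] u v hu hv; first by rewrite add0n ideal_expMl.
case/asboolP: hu => r [a [b [ha hb ->]]].
apply/asboolP; exists r, a, (fun l => b l * v); split=> // [l|].
  exact: IH (hb l) hv.
by rewrite mulr_suml; apply: eq_bigr => l _; rewrite mulrA.
Qed.

Lemma ideal_expS j : {subset ideal_exp m j.+1 <= ideal_exp m j}.
Proof.
move=> u /asboolP[r [a [b [ha hb ->]]]].
by apply: ideal_exp_sum => i _; apply: ideal_expMl.
Qed.

Lemma ideal_exp1 : ideal_exp m 1 =i m.
Proof.
move=> x; apply/asboolP/idP => [[r [a [b [ha _ ->]]]]|hx].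
  by apply: rpred_sum => i _; rewrite mulrC idealMr.
by exists 1%N, (fun=> x), (fun=> 1); split=> //; rewrite big_ord1 mulr1.
Qed.

End IdealPowers.

(* The associated graded ring \bigoplus_j m^j / m^(j+1) is built as the quotient
   of the Rees algebra \bigoplus_j m^j 'X^j, a subring of {poly A}, by its ideal
   \bigoplus_j m^(j+1) 'X^j. *)
Section AssociatedGraded.
Variables (k : fieldType) (A : comAlgType k) (m : idealr A).

Definition rees_pred : {pred {poly A}} := fun p =>
  `[< forall j, p`_j \in ideal_exp m j >].

Lemma rees_pred_subring : subring_closed rees_pred.
Proof.
split.
- apply/asboolP => -[|j]; first by [].
  by rewrite coef1 ideal_exp0.
- move=> p q /asboolP hp /asboolP hq; apply/asboolP => j.
  by rewrite coefB -mulN1r ideal_expD ?ideal_expMl.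
move=> p q /asboolP hp /asboolP hq; apply/asboolP => j.
rewrite coefM; apply: ideal_exp_sum => i _.
by rewrite -[X in ideal_exp m X](subnKC (leq_ord i)) ideal_exp_mul.
Qed.

HB.instance Definition _ :=
  GRing.isSubringClosed.Build {poly A} rees_pred rees_pred_subring.

Record rees := Rees { rees_val :> {poly A}; _ : rees_val \in rees_pred }.

HB.instance Definition _ := [isSub for rees_val].
HB.instance Definition _ := [Choice of rees by <:].
HB.instance Definition _ := [SubChoice_isSubComNzRing of rees by <:].

Lemma rees_valD (p q : rees) : rees_val (p + q) = rees_val p + rees_val q.
Proof. exact: (rmorphD (val : rees -> {poly A})). Qed.

Lemma rees_valM (p q : rees) : rees_val (p * q) = rees_val p * rees_val q.
Proof. exact: (rmorphM (val : rees -> {poly A})). Qed.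

Lemma rees_val1 : rees_val 1 = 1.
Proof. exact: (rmorph1 (val : rees -> {poly A})). Qed.

Lemma rees_val_sum (T : Type) (s : seq T) (P : pred T) (F : T -> rees) :
  rees_val (\sum_(i <- s | P i) F i) = \sum_(i <- s | P i) rees_val (F i).
Proof. exact: (raddf_sum (val : rees -> {poly A})). Qed.

Lemma rees_coefP (p : rees) j : (p : {poly A})`_j \in ideal_exp m j.
Proof. by case: p => p /= /asboolP. Qed.

Definition rees_ideal : {pred rees} := fun p =>
  `[< forall j, (p : {poly A})`_j \in ideal_exp m j.+1 >].

Lemma rees_ideal_closed : idealr_closed rees_ideal.
Proof.
split.
- by apply/asboolP => j; rewrite [val _]/= coef0 ideal_exp0.
- apply/negP => /asboolP /(_ 0%N).
  by rewrite coef1 ideal_exp1 idealr1.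
move=> p q r /asboolP hq /asboolP hr; apply/asboolP => j.
rewrite coefD coefM; apply: ideal_expD => //.
apply: ideal_exp_sum => i _.
have := ideal_exp_mul (rees_coefP p i) (hq (j - i)%N).
by rewrite addnS subnKC // leq_ord.
Qed.

HB.instance Definition _ := isIdealr.Build rees rees_ideal rees_ideal_closed.

Definition gr : Type := {ideal_quot rees_ideal}.

HB.instance Definition _ := GRing.ComNzRing.on gr.

Lemma rees_monomialP j a :
  a \in ideal_exp m j -> a *: 'X^j \in rees_pred.
Proof.
move=> ha; apply/asboolP => i; rewrite coefZ coefXn.
by case: eqP => [->|_]; rewrite ?mulr1 // mulr0 ideal_exp0.
Qed.

(* For a in m^j, the class of a in the component m^j / m^(j+1) of gr. *)
Definition gr_form (j : nat) (a : A) : gr :=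
  \pi_{ideal_quot rees_ideal} (insubd (0 : rees) (a *: 'X^j)).

Lemma val_rees_monomial j a : a \in ideal_exp m j ->
  rees_val (insubd (0 : rees) (a *: 'X^j)) = a *: 'X^j.
Proof. by move=> ha; apply: (insubdK (0 : rees)); apply: rees_monomialP. Qed.

Lemma gr_formD j : {in ideal_exp m j &, {morph gr_form j : a b / a + b}}.
Proof.
move=> a b ha hb; rewrite /gr_form -[RHS](rmorphD (\pi_{ideal_quot rees_ideal})).
congr (\pi _); apply: val_inj; rewrite [LHS]/= [RHS]rees_valD.
by rewrite !val_rees_monomial ?ideal_expD // scalerDl.
Qed.

Lemma gr_formM i j : {in ideal_exp m i & ideal_exp m j, forall a b,
  gr_form i a * gr_form j b = gr_form (i + j) (a * b)}.
Proof.
move=> a b ha hb; rewrite /gr_form -[LHS](rmorphM (\pi_{ideal_quot rees_ideal})).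
congr (\pi _); apply: val_inj; rewrite [LHS]rees_valM [RHS]/=.
rewrite !val_rees_monomial ?ideal_exp_mul //.
by rewrite -!mul_polyC polyCM exprD mulrACA.
Qed.

Lemma gr_form01 : gr_form 0 1 = 1.
Proof.
rewrite /gr_form -[RHS](rmorph1 (\pi_{ideal_quot rees_ideal})).
congr (\pi _); apply: val_inj; rewrite [RHS]rees_val1.
by rewrite [LHS]val_rees_monomial // expr0 scale1r.
Qed.

(* The component of degree j is m^j / m^(j+1). *)
Lemma gr_form_eq0 j a : a \in ideal_exp m j ->
  (gr_form j a == 0) = (a \in ideal_exp m j.+1).
Proof.
move=> ha; rewrite /gr_form -(rmorph0 (\pi_{ideal_quot rees_ideal})).
rewrite -Quotient.idealrBE subr0; apply/asboolP/idP => [/(_ j)|ha' i].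
  by rewrite val_rees_monomial // coefZ coefXn eqxx mulr1.
rewrite val_rees_monomial // coefZ coefXn.
by case: eqP => [->|_]; rewrite ?mulr1 // mulr0 ideal_exp0.
Qed.

(* gr is spanned by its homogeneous components. *)
Lemma gr_form_sum (x : gr) : exists (p : rees),
  x = \sum_(j < size (p : {poly A})) gr_form j (p : {poly A})`_j.
Proof.
elim/quotW: x => p; exists p.
rewrite /gr_form -[RHS](raddf_sum (\pi_{ideal_quot rees_ideal})).
congr (\pi _); apply: val_inj; rewrite [RHS]rees_val_sum [LHS]/=.
rewrite -[LHS]coefK poly_def; apply: eq_bigr => j _.
by rewrite val_rees_monomial // rees_coefP.
Qed.

(* The components are in direct sum. *)
Lemma gr_form_sum_eq0 (p : rees) :
  \sum_(j < size (p : {poly A})) gr_form j (p : {poly A})`_j = 0 ->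
  forall j, gr_form j (p : {poly A})`_j = 0.
Proof.
have -> : \sum_(j < size (p : {poly A})) gr_form j (p : {poly A})`_j =
    \pi_{ideal_quot rees_ideal} p.
  rewrite /gr_form -[LHS](raddf_sum (\pi_{ideal_quot rees_ideal})).
  congr (\pi _); apply: val_inj; rewrite [LHS]rees_val_sum [RHS]/=.
  rewrite -[RHS]coefK poly_def; apply: eq_bigr => j _.
  by rewrite val_rees_monomial // rees_coefP.
move=> p0 j; have /asboolP hp : p \in rees_ideal.
  rewrite -[p]subr0 Quotient.idealrBE.
  by rewrite [X in _ == X](rmorph0 (\pi_{ideal_quot rees_ideal})); apply/eqP.
by apply/eqP; rewrite gr_form_eq0 ?rees_coefP.
Qed.

Definition gr_scale (c : k) (x : gr) : gr := gr_form 0 c%:A * x.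

Lemma gr_scaleA a b x : gr_scale a (gr_scale b x) = gr_scale (a * b) x.
Proof. by rewrite /gr_scale mulrA gr_formM // -scalerAl mul1r scalerA. Qed.

Lemma gr_scale1 : left_id 1 gr_scale.
Proof. by move=> x; rewrite /gr_scale scale1r gr_form01 mul1r. Qed.

Lemma gr_scaleDr : right_distributive gr_scale +%R.
Proof. by move=> a x y; rewrite /gr_scale mulrDr. Qed.

Lemma gr_scaleDl x : {morph gr_scale^~ x : a b / a + b}.
Proof. by move=> a b; rewrite /gr_scale scalerDl gr_formD // mulrDl. Qed.

HB.instance Definition _ := GRing.Zmodule_isLmodule.Build k gr
  gr_scaleA gr_scale1 gr_scaleDr gr_scaleDl.

Lemma gr_scaleAl (a : k) (x y : gr) : a *: (x * y) = (a *: x) * y.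
Proof. exact: mulrA. Qed.

HB.instance Definition _ := GRing.Lmodule_isLalgebra.Build k gr gr_scaleAl.
HB.instance Definition _ := GRing.Lalgebra_isComAlgebra.Build k gr.

End AssociatedGraded.

(* Main.v *)
From HB Require Import structures.
Require Import Defs.
From mathcomp Require Import all_boot all_algebra.
From mathcomp Require Import boolp.
From mathcomp Require Import ring.

(** Write m^j for the powers of the maximal ideal, so that m^4 = 0.

    An algebra is isomorphic to its associated graded ring as soon as the
    m-adic filtration splits multiplicatively, that is, there are complements W_j of
    m^(j+1) in m^j such that 1 is in W_0 and W_i W_j lies in W_(i+j)
    (graded_of_splitting). Here W_0 = k and W_3 = m^3 are forced, and m^4 = 0
    makes every condition automatic except one: lifts x_1, ..., x_e of a basis
    of m / m^2 must be found whose products x_i x_j lie in some complement W_2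
    of m^3 in m^2 (graded_of_quadrics).

    If n = binomial(e + 1, 2), there are no quadratic relations: the products
    x_i x_j with i <= j span m^2 modulo m^3 and are as many as its dimension,
    so for any lifts their span is itself such a complement.

    If n = tau e, let W_2 be any complement and let pi : m^2 -> m^3 be the
    projection along it. Multiplication gives a linear map from m^2 / m^3 to
    Hom(m / m^2, m^3); since the socle is m^3 it is injective, and since both
    sides have dimension tau e it is onto (mul_surjective). Hence there are
    y_i in m^2 with y_i x_j = - pi(x_i x_j) / 2 for all j. As y_i y_j is in
    m^4 = 0,
      (x_i + y_i) (x_j + y_j) = x_i x_j - pi(x_i x_j),
    which lies in W_2, so the lifts x_i + y_i are as wanted
    (quadrics_of_lift). *)

Set Implicit Arguments.
Unset Strict Implicit.
Unset Printing Implicit Defensive.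

Import GRing.Theory.
Local Open Scope ring_scope.
Local Open Scope quotient_scope.

(** * Ideals as linear subspaces *)

Section IdealClosure.
Variables (k : fieldType) (A : comAlgType k) (I : {pred A}).
Hypothesis I_ideal : is_ideal I.

Lemma is_ideal0 : 0 \in I.
Proof. by case: I_ideal. Qed.

Lemma is_idealD u v : u \in I -> v \in I -> u + v \in I.
Proof.
by move=> hu hv; case: I_ideal => _ /(_ 1 _ _ hu hv); rewrite mul1r.
Qed.

Lemma is_idealZ c u : u \in I -> c *: u \in I.
Proof.
move=> hu; case: I_ideal => h0 /(_ c%:A _ _ hu h0).
by rewrite addr0 -scalerAl mul1r.
Qed.

Lemma is_idealB u v : u \in I -> v \in I -> u - v \in I.
Proof. by move=> hu hv; rewrite is_idealD // -scaleN1r is_idealZ. Qed.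

Lemma is_ideal_sum (T : finType) (F : T -> A) :
  (forall i, F i \in I) -> \sum_i F i \in I.
Proof.
move=> h; apply: (big_ind (fun x => x \in I)) => //; first exact: is_ideal0.
exact: is_idealD.
Qed.

End IdealClosure.

(** * Complements and bases modulo a subspace *)

Section Complements.
Variables (k : fieldType) (A : comAlgType k).
Implicit Types (U V : {pred A}) (W : A -> Prop).

Definition lin_span (T : finType) (b : T -> A) : A -> Prop :=
  fun u => exists c : T -> k, u = \sum_i c i *: b i.

Record complement_mod W U V : Prop := ComplementMod {
  complement_sub : forall u, W u -> u \in U;
  complement_lin : forall c u v, W u -> W v -> W (c *: u + v);
  complement_ex : forall u, u \in U -> exists2 w, W w & u - w \in V;
  complement_eq0 : forall u, W u -> u \in V -> u = 0 }.

(** The existential body of [dim_quot], so that a basis can be exhibited and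
    then modified. *)
Definition basis_mod U V (d : nat) (b : 'I_d -> A) : Prop :=
  (forall i, b i \in U) /\
  forall u, u \in U -> exists! c : 'rV[k]_d, u - \sum_i c 0 i *: b i \in V.

Lemma complement0 W U V : complement_mod W U V -> 0 \in U -> W 0.
Proof.
move=> hW U0; have [w Ww _] := complement_ex hW U0.
by have := complement_lin hW (-1) Ww Ww; rewrite scaleN1r addNr.
Qed.

Lemma complementD W U V u v :
  complement_mod W U V -> W u -> W v -> W (u + v).
Proof. by move=> hW hu; rewrite -[u]scale1r; apply: (complement_lin hW). Qed.

Lemma complement_sum W U V (T : finType) (F : T -> A) :
  complement_mod W U V -> 0 \in U ->
  (forall i, W (F i)) -> W (\sum_i F i).
Proof.
move=> hW U0 hF; apply: (big_ind W) => // [|u v]; first exact: complement0 hW U0.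
exact: complementD hW.
Qed.

Lemma complementZ W U V c u :
  complement_mod W U V -> 0 \in U -> W u -> W (c *: u).
Proof.
move=> hW U0 hu; rewrite -[_ *: _]addr0.
exact: (complement_lin hW) (complement0 hW U0).
Qed.

Lemma lin_span_lin (T : finType) (b : T -> A) c u v :
  lin_span b u -> lin_span b v -> lin_span b (c *: u + v).
Proof.
move=> [f ->] [g ->]; exists (fun i => c * f i + g i).
rewrite scaler_sumr -big_split /=; apply: eq_bigr => i _.
by rewrite scalerDl scalerA.
Qed.

Lemma lin_span_mem (T : finType) (b : T -> A) i : lin_span b (b i).
Proof.
exists (fun j => (j == i)%:R); rewrite (bigD1 i) //= eqxx scale1r.
by rewrite big1 ?addr0 // => j /negbTE ->; rewrite scale0r.
Qed.

Lemma basis_mod_eq0 U V d (b : 'I_d -> A) (c : 'rV[k]_d) :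
  is_ideal U -> is_ideal V -> basis_mod U V b ->
  \sum_i c 0 i *: b i \in V -> c = 0.
Proof.
move=> hU hV [hb hbas] hc; have [c0 [_ uniq0]] := hbas _ (is_ideal0 hU).
have c00 : c0 = 0.
  by apply: uniq0; rewrite big1 ?subr0 ?is_ideal0 // => i _; rewrite mxE scale0r.
apply/eqP; rewrite -oppr_eq0 -(uniq0 (- c)) ?c00 //.
rewrite add0r -sumrN; under eq_bigr => i _ do rewrite mxE scaleNr opprK.
exact: hc.
Qed.

Lemma complement_basis U V d (b : 'I_d -> A) :
  is_ideal U -> is_ideal V -> basis_mod U V b ->
  complement_mod (lin_span b) U V.
Proof.
move=> hU hV hb; have [bU bas] := hb; split.
- by move=> u [c ->]; apply: is_ideal_sum => // i; exact: is_idealZ.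
- by move=> c u v; apply: lin_span_lin.
- move=> u /bas[c [hc _]]; exists (\sum_i c 0 i *: b i) => //.
  by exists (c 0).
- move=> u [c ->] hc; rewrite big1 // => i _.
  have -> : c i = (\row_j c j) 0 i by rewrite mxE.
  rewrite (basis_mod_eq0 (c := \row_j c j) hU hV hb) ?mxE ?scale0r //.
  by under eq_bigr => j _ do rewrite mxE.
Qed.

Lemma basis_mod_translate U V d (b y : 'I_d -> A) :
  is_ideal U -> is_ideal V -> {subset V <= U} -> basis_mod U V b ->
  (forall i, y i \in V) -> basis_mod U V (fun i => b i + y i).
Proof.
move=> hU hV VU [bU bas] hy; split=> [i|u /bas[c [hc uc]]].
  by rewrite is_idealD // VU.
have E (c' : 'rV[k]_d) : u - \sum_i c' 0 i *: b i =
    u - \sum_i c' 0 i *: (b i + y i) + \sum_i c' 0 i *: y i.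
  under [in RHS]eq_bigr => i _ do rewrite scalerDr.
  by rewrite big_split /= opprD addrA subrK.
have yV (c' : 'rV[k]_d) : \sum_i c' 0 i *: y i \in V.
  by apply: is_ideal_sum => // i; exact: is_idealZ.
exists c; split=> [|c' hc'].
  by have := is_idealB hV hc (yV c); rewrite E addrK.
by apply: uc; rewrite E is_idealD.
Qed.

Lemma lin_comb_enum (T : finType) (b : T -> A) (c : T -> k) :
  \sum_i c i *: b i =
    \sum_(l < #|T|) (\row_(j < #|T|) c (enum_val j)) 0 l *: b (enum_val l).
Proof.
under [RHS]eq_bigr => l _ do rewrite mxE.
by rewrite -(big_enum_val (fun i => c i *: b i)).
Qed.

(** A spanning family whose length is the dimension is a basis: its square
    coordinate matrix in a given basis is row-full, hence row-free. *)
Lemma complement_spanning U V (T : finType) (b : T -> A) :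
  is_ideal U -> is_ideal V -> dim_quot U V #|T| ->
  (forall i, b i \in U) ->
  (forall u, u \in U -> exists2 w, lin_span b w & u - w \in V) ->
  complement_mod (lin_span b) U V.
Proof.
move=> hU hV [b0 hb0] bU bspan; have [b0U bas] := hb0.
split=> //.
- by move=> u [c ->]; apply: is_ideal_sum => // i; exact: is_idealZ.
- by move=> c u v; apply: lin_span_lin.
have [|M hM] := @choice _ _ (fun (l : 'I_#|T|) (c : 'rV[k]_#|T|) =>
    b (enum_val l) - \sum_i c 0 i *: b0 i \in V).
  by move=> l; have [c [hc _]] := bas _ (bU (enum_val l)); exists c.
pose N := \matrix_l M l.
(* N is the coordinate matrix of b, so c *m N computes coordinates mod V. *)
have EN (c : 'rV[k]_#|T|) :
    \sum_l c 0 l *: b (enum_val l) - \sum_i (c *m N) 0 i *: b0 i \in V.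
  under [X in _ - X]eq_bigr => i _.
    rewrite mxE scaler_suml; under eq_bigr => l _ do rewrite mxE -scalerA; over.
  rewrite exchange_big /= -sumrB; apply: is_ideal_sum => // l.
  by rewrite -scaler_sumr -scalerBr; apply: is_idealZ.
have Nfull : row_full N.
  apply/row_fullP.
  have [|B hB] := @choice _ _ (fun (l : 'I_#|T|) (c : 'rV[k]_#|T|) =>
      c *m N = delta_mx 0 l).
    move=> l; have [w [c ->] hc] := bspan _ (b0U l).
    exists (\row_i c (enum_val i)); apply/eqP; rewrite -subr_eq0; apply/eqP.
    apply: (basis_mod_eq0 hU hV hb0).
    set r := \row_i _.
    have := is_idealD hV hc (EN r).
    rewrite lin_comb_enum addrA subrK => /(is_idealZ hV (-1)).
    rewrite scaleN1r opprB; congr (_ \in V).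
    have coordB i : (r *m N - delta_mx 0 l) 0 i = (r *m N) 0 i - (i == l)%:R.
      by rewrite mxE; congr (_ + _); rewrite !mxE eqxx.
    under [RHS]eq_bigr => i _ do rewrite coordB scalerBl.
    rewrite sumrB; congr (_ - _).
    rewrite (bigD1 l) //= eqxx scale1r big1 ?addr0 // => i /negbTE ->.
    by rewrite scale0r.
  exists (\matrix_l B l); apply/row_matrixP => l.
  by rewrite row_mul rowK hB row1.
have Nfree : row_free N by rewrite -row_leq_rank (eqP Nfull).
move=> u [c ->] hc.
pose r : 'rV[k]_#|T| := \row_i c (enum_val i).
rewrite lin_comb_enum -/r in hc *.
have r0 : r = 0.
  apply: (row_free_inj Nfree); rewrite mul0mx.
  apply: (basis_mod_eq0 hU hV hb0).
  have := is_idealB hV hc (EN r); rewrite subKr; exact.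
by rewrite big1 // => i _; rewrite r0 mxE scale0r.
Qed.

End Complements.

(** * Splittings of the filtration *)

Lemma ideal_exp_le (k : fieldType) (A : comAlgType k) (m : idealr A) i j :
  (i <= j)%N -> {subset ideal_exp m j <= ideal_exp m i}.
Proof.
move=> /subnK <- u; elim: (j - i)%N => // l IHl hu.
by apply: IHl; apply: ideal_expS; rewrite -addSn.
Qed.

Section GradedOfSplitting.
Variables (k : fieldType) (A : comAlgType k) (m : idealr A) (s : nat).
Variable W : nat -> A -> Prop.
Hypothesis mS : ideal_exp m s.+1 =i pred1 0.
Hypothesis W_compl :
  forall j, complement_mod (W j) (ideal_exp m j) (ideal_exp m j.+1).
Hypothesis W1 : W 0 1.
Hypothesis WM : forall i j u v, W i u -> W j v -> W (i + j) (u * v).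

Local Notation gr_pi := (\pi_{ideal_quot (@rees_ideal k A m)}).

(** The polynomials with coefficients in the W_j form a subring of the Rees
    algebra. Evaluation at 1 maps it bijectively onto A, and reduction maps it
    bijectively onto the associated graded ring. *)
Definition homogeneous_lift (p : {poly A}) := forall j, W j p`_j.

Let W_0 j : W j 0.
Proof. exact: complement0 (W_compl j) (ideal_exp0 m j). Qed.

Let homogeneous_lift_lin c p q :
  homogeneous_lift p -> homogeneous_lift q -> homogeneous_lift (c%:A *: p + q).
Proof.
move=> hp hq j; rewrite coefD coefZ -scalerAl mul1r.
exact: complement_lin (W_compl j) _ _ _ (hp j) (hq j).
Qed.

Let homogeneous_liftM p q :
  homogeneous_lift p -> homogeneous_lift q -> homogeneous_lift (p * q).
Proof.
move=> hp hq j; rewrite coefM.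
apply: (complement_sum (W_compl j) (ideal_exp0 m j)) => i.
by rewrite -[X in W X](subnKC (leq_ord i)); apply: WM.
Qed.

Let homogeneous_lift1 : homogeneous_lift 1.
Proof. by move=> [|j]; rewrite coef1. Qed.

Let homogeneous_lift_rees p : homogeneous_lift p -> p \in rees_pred m.
Proof. by move=> hp; apply/asboolP => j; exact: (complement_sub (W_compl j)). Qed.

Let ideal_exp_gt_s j u : (s < j)%N -> u \in ideal_exp m j -> u = 0.
Proof.
by move=> /ideal_exp_le h /h; rewrite mS => /eqP.
Qed.

(** Peel off the W_j-component, moving from m^j to m^(j+1) until m^(s+1) = 0. *)
Let homogeneous_lift_ex j a : a \in ideal_exp m j ->
  exists2 p, homogeneous_lift p & p.[1] = a.
Proof.
have [d] := ubnP (s.+1 - j)%N; elim: d => // d IH in j a * => hd ha.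
have [sj|js] := ltnP s j.
  exists 0; first by move=> i; rewrite coef0.
  by rewrite horner0 (ideal_exp_gt_s sj ha).
have [w Ww hw] := complement_ex (W_compl j) ha.
have [|p hp pE] := IH j.+1 (a - w) _ hw.
  by move: hd; rewrite subSn // subSS ltnS.
exists (w *: 'X^j + p); last first.
  by rewrite hornerD hornerZ hornerXn expr1n mulr1 pE addrC subrK.
move=> i; rewrite coefD coefZ coefXn; apply: (complementD (W_compl i)) (hp i).
by case: eqP => [->|_]; rewrite ?mulr1 // mulr0.
Qed.

(** If the coefficients below j vanish, the value at 1 shows that the j-th one
   lies in m^(j+1), which meets W_j trivially. *)
Let homogeneous_lift_inj p :
  homogeneous_lift p -> p.[1] = 0 -> p = 0.
Proof.
move=> hp p1.
suff h j : forall i, (i < j)%N -> p`_i = 0.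
  by apply/polyP => i; rewrite coef0 (h i.+1).
elim: j => // j IH i; rewrite ltnS leq_eqVlt => /orP[/eqP ->|]; last exact: IH.
apply: (complement_eq0 (W_compl j) (hp j)).
have [szj|jsz] := leqP (size p) j; first by rewrite nth_default ?ideal_exp0.
move: p1; rewrite horner_coef; under eq_bigr => i' _ do rewrite expr1n mulr1.
rewrite (bigD1 (Ordinal jsz)) // => /eqP; rewrite addr_eq0 => /eqP E.
rewrite (E : p`_j = _).
rewrite -mulN1r ideal_expMl //; apply: ideal_exp_sum => i' ne.
have [lt|ge] := ltnP i' j; first by rewrite IH ?ideal_exp0.
have gt : (j < i')%N.
  by rewrite ltn_neqAle ge andbT; apply: contra ne => /eqP ij; apply/eqP/val_inj.
exact: (ideal_exp_le gt) (complement_sub (W_compl i') (hp i')).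
Qed.

(** The isomorphism sends a to the class of the homogeneous lift P a with value
    a at 1. Uniqueness of that lift makes P a morphism of algebras, because
    sums, products and multiples of homogeneous lifts are homogeneous lifts. *)
Lemma graded_of_splitting : exists f : {lrmorphism A -> gr m}, bijective f.
Proof.
have [|P hP] := @choice _ _ (fun a p => homogeneous_lift p /\ p.[1] = a).
  move=> a; have [//|p] := @homogeneous_lift_ex 0 a.
  by exists p.
have Puniq p : homogeneous_lift p -> P p.[1] = p.
  move=> hp; have [hq Eq] := hP p.[1].
  have E : (-1)%:A *: p + P p.[1] = P p.[1] - p by rewrite !scaleN1r addrC.
  apply/eqP; rewrite -subr_eq0 -E; apply/eqP/homogeneous_lift_inj.
    exact: homogeneous_lift_lin.
  by rewrite E hornerD hornerN Eq subrr.
pose Q a : rees m := Rees (homogeneous_lift_rees (proj1 (hP a))).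
have QE a p : homogeneous_lift p -> p.[1] = a -> rees_val (Q a) = p.
  by move=> hp <-; rewrite /= Puniq.
have QL a : homogeneous_lift (rees_val (Q a)) by case: (hP a).
have Q1 a : (rees_val (Q a)).[1] = a by case: (hP a).
pose f a : gr m := gr_pi (Q a).
have fB : zmod_morphism f.
  move=> a b; rewrite /f -[RHS](rmorphB gr_pi).
  congr (\pi _); apply: val_inj; apply: QE.
    have := homogeneous_lift_lin (-1) (QL b) (QL a).
    by rewrite scaleN1r scaleN1r addrC.
  by rewrite [X in X.[1]](rmorphB (val : rees m -> _)) hornerD hornerN !Q1.
have fM : monoid_morphism f.
  split=> [|a b].
    rewrite /f -[RHS](rmorph1 gr_pi).
    congr (\pi _); apply: val_inj; rewrite [RHS]rees_val1.
    by apply: QE; rewrite ?hornerC.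
  rewrite /f -[RHS](rmorphM gr_pi).
  congr (\pi _); apply: val_inj; rewrite [RHS]rees_valM.
  by apply: QE; [exact: homogeneous_liftM | rewrite hornerM !Q1].
have fZ : scalable f.
  move=> c a; rewrite /f [RHS]/GRing.scale /= /gr_scale /gr_form.
  rewrite -[RHS](rmorphM gr_pi).
  congr (\pi _); apply: val_inj; rewrite [RHS]rees_valM.
  rewrite val_rees_monomial // expr0 alg_polyC mul_polyC.
  apply: QE; last by rewrite hornerZ Q1 -scalerAl mul1r.
  rewrite -[_ *: _]addr0; apply: homogeneous_lift_lin => //.
  by move=> j; rewrite coef0.
pose F : {lrmorphism A -> gr m} := HB.pack f
  (GRing.isZmodMorphism.Build _ _ f fB) (GRing.isMonoidMorphism.Build _ _ f fM)
  (GRing.isScalable.Build _ _ _ _ f fZ).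
exists F.
have f_eq (q q' : rees m) :
    (gr_pi q = gr_pi q') <->
    forall j, (rees_val q)`_j - (rees_val q')`_j \in ideal_exp m j.+1.
  have E : (gr_pi q ==
      gr_pi q') = (q - q' \in @rees_ideal k A m).
    by rewrite Quotient.idealrBE.
  have E' j : (rees_val (q - q'))`_j = (rees_val q)`_j - (rees_val q')`_j.
    by rewrite [rees_val _](rmorphB (val : rees m -> _)) coefB.
  split=> [/eqP|h]; first by rewrite E => /asboolP h j; rewrite -E'.
  by apply/eqP; rewrite E; apply/asboolP => j; rewrite E'.
have f_inj : injective f.
  move=> a b /f_eq h; rewrite -(Q1 a) -(Q1 b); congr _.[1].
  apply/polyP => j; apply/eqP; rewrite -subr_eq0; apply/eqP.
  apply: (complement_eq0 (W_compl j) _ (h j)).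
  by rewrite addrC -scaleN1r; apply: (complement_lin (W_compl j)); apply: QL.
have f_surj x : exists a, f a = x.
  elim/quotW: x => q.
  have [|w hw] := @choice _ _ (fun j u =>
      W j u /\ (rees_val q)`_j - u \in ideal_exp m j.+1).
    by move=> j; have [u] := complement_ex (W_compl j) (rees_coefP q j); exists u.
  pose p := \poly_(j < s.+1) w j.
  have pL : homogeneous_lift p.
    by move=> j; rewrite coef_poly; case: ifP => // _; case: (hw j).
  exists p.[1]; apply/f_eq => j; rewrite (QE _ _ pL erefl) coef_poly.
  have [hj|hj] := ifP; last first.
    rewrite (ideal_exp_gt_s _ (rees_coefP q j)) ?subrr ?ideal_exp0 //.
    by rewrite ltnNge -ltnS hj.
  by rewrite -opprB -mulN1r ideal_expMl //; case: (hw j).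
have [g gK] := choice f_surj.
by exists g => [a|x]; rewrite /= ?gK //; apply: f_inj; rewrite gK.
Qed.

End GradedOfSplitting.

(** * Local algebras with m^4 = 0 *)

Section SocleDegreeThree.
Variables (k : fieldType) (A : comAlgType k) (m : idealr A).
Hypothesis m4 : ideal_exp m 4 =i pred1 0.
Local Notation "'m^ j" := (ideal_exp m j) (at level 3, j at level 2).

(** In degrees other than 2 the splitting is free: k, the span of the x_i, and
    m^3. Products of total degree 3 lie in m^3 and higher ones vanish, so that
    only W_1 W_1 <= W_2 has to be assumed. *)
Lemma graded_of_quadrics e (x : 'I_e -> A) (W2 : A -> Prop) :
  has_residue_field_k m -> basis_mod ('m^1) ('m^2) x ->
  complement_mod W2 ('m^2) ('m^3) -> (forall i j, W2 (x i * x j)) ->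
  exists f : {lrmorphism A -> gr m}, bijective f.
Proof.
move=> hres hx hW2 xx.
pose W (j : nat) : A -> Prop := match j with
  | 0 => fun u => exists c : k, u = c%:A
  | 1 => lin_span x
  | 2 => W2
  | 3 => fun u => u \in 'm^3
  | _ => fun u => u = 0
  end.
have I j : is_ideal ('m^j) by exact: ideal_expP.
have m0 j u : (3 < j)%N -> u \in 'm^j -> u = 0.
  by move=> /ideal_exp_le h /h; rewrite m4 => /eqP.
have WC j : complement_mod (W j) ('m^j) ('m^j.+1).
  case: j => [|[|[|[|j]]]] //.
  - split=> //.
    + by move=> c u v [a ->] [b ->]; exists (c * a + b); rewrite scalerDl scalerA.
    + move=> u _; have [c [hc _]] := hres u; exists c%:A; first by exists c.
      by rewrite ideal_exp1.
    + move=> u [c ->]; rewrite ideal_exp1 => hc.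
      have [c' [_ uc]] := hres c%:A.
      rewrite -(uc c) ?subrr ?rpred0 // (uc 0) ?scale0r //.
      by rewrite subr0.
  - exact: complement_basis.
  - split=> //.
    + by move=> c u v hu hv; apply: (is_idealD (I 3%N) (is_idealZ (I 3%N) c hu) hv).
    + by move=> u hu; exists u => //; rewrite subrr ideal_exp0.
    + by move=> u _; apply: m0.
  - split=> //.
    + by move=> u ->; apply: ideal_exp0.
    + by move=> c u v -> ->; rewrite scaler0 addr0.
    + by move=> u hu; exists 0 => //; rewrite subr0 (m0 _ _ _ hu) ?ideal_exp0.
have WM0 j c u : W j u -> W j (c%:A * u).
  move=> hu; rewrite -scalerAl mul1r.
  exact: (complementZ _ (WC j) (ideal_exp0 m j) hu).
apply: (@graded_of_splitting k A m 3 W) => //; first by exists 1; rewrite scale1r.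
move=> i j u v hu hv.
have uv := ideal_exp_mul (complement_sub (WC i) hu) (complement_sub (WC j) hv).
have [gt3|le3] := ltnP 3 (i + j).
  by rewrite (m0 _ _ gt3 uv); apply: complement0 (WC _) (ideal_exp0 m _).
case: i hu uv le3 => [[c ->] _ _|i hu]; first exact: WM0.
case: j hv => [[c ->] _ _|j hv].
  by rewrite addn0 mulrC; apply: WM0.
case: i hu => [|i] hu; case: j hv => [|j] hv uv le3.
- move: hu hv => [c ->] [d ->]; rewrite mulr_suml.
  apply: (complement_sum hW2 (ideal_exp0 m 2)) => i; rewrite mulr_sumr.
  apply: (complement_sum hW2 (ideal_exp0 m 2)) => i'.
  rewrite -scalerAr -scalerAl.
  by do 2!apply: (complementZ _ hW2 (ideal_exp0 m 2)).
- by case: j hv uv le3.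
- by move: uv le3; rewrite addn1; case: i {hu}.
by move: le3; rewrite !addSn !addnS.
Qed.

(** The degree 2 monomials in x, listed without repetition: the number of
    indices has to be the dimension of the space of quadratic forms. *)
Definition ordered_products e (x : 'I_e -> A)
    (p : {p : 'I_e * 'I_e | p.1 <= p.2}%N) : A :=
  x (val p).1 * x (val p).2.

Lemma ordered_products_mem e (x : 'I_e -> A) i j :
  lin_span (ordered_products x) (x i * x j).
Proof.
wlog ij : i j / (i <= j)%N.
  by move=> H; case/orP: (leq_total i j) => /H //; rewrite mulrC.
exact: (lin_span_mem _ (Sub (i, j) ij : {p : 'I_e * 'I_e | p.1 <= p.2}%N)).
Qed.

(** Replacing both factors of a product by their linear parts in x changes it
    by an element of m^3. *)
Lemma ordered_products_span e (x : 'I_e -> A) u :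
  basis_mod ('m^1) ('m^2) x -> u \in 'm^2 ->
  exists2 w, lin_span (ordered_products x) w & u - w \in 'm^3.
Proof.
move=> hx /asboolP[r [a [b [ha hb ->]]]].
set S := lin_span _.
have SD v w : S v -> S w -> S (v + w).
  by move=> hv hw; rewrite -[v]scale1r; apply: lin_span_lin.
have S0 : S 0.
  by exists (fun=> 0); rewrite big1 // => i _; rewrite scale0r.
have SZ c v : S v -> S (c *: v).
  by move=> hv; rewrite -[_ *: _]addr0; apply: lin_span_lin.
have [bU bas] := hx.
have ab i : exists2 w, S w & a i * b i - w \in 'm^3.
  have ai : a i \in 'm^1 by rewrite ideal_exp1.
  have bi : b i \in 'm^1 by exact: hb.
  have [c [hc _]] := bas _ ai; have [d [hd _]] := bas _ bi.
  set v := \sum_j _ in hc; set w := \sum_j _ in hd.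
  exists (v * w).
    rewrite /v mulr_suml; apply: (big_ind S) => // j _.
    rewrite /w mulr_sumr; apply: (big_ind S) => // l _.
    by rewrite -scalerAr -scalerAl; apply/SZ/SZ/ordered_products_mem.
  have -> : a i * b i - v * w = b i * (a i - v) + v * (b i - w) by ring.
  have hv : v \in 'm^1.
    by apply: ideal_exp_sum => j _; apply: is_idealZ; first exact: ideal_expP.
  exact: (ideal_expD (ideal_exp_mul bi hc) (ideal_exp_mul hv hd)).
have [|w hw] := @choice _ _ (fun i w => S w /\ a i * b i - w \in 'm^3).
  by move=> i; have [w] := ab i; exists w.
exists (\sum_i w i).
  by apply: (big_ind S) => // i _; case: (hw i).
by rewrite -sumrB; apply: ideal_exp_sum => i _; case: (hw i).
Qed.

Lemma card_ordered_pairs e :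
  #|{: {p : 'I_e * 'I_e | p.1 <= p.2}%N}| = 'C(e.+1, 2).
Proof.
rewrite card_sig -sum1_card.
rewrite (eq_bigl (fun p : 'I_e * 'I_e => true && (p.1 <= p.2)%N)) //.
rewrite -(pair_big_dep xpredT (fun i j : 'I_e => (i <= j)%N) (fun _ _ => 1%N)) /=.
rewrite (exchange_big_dep xpredT) //= -bin2_sum big_nat_recl // add0n big_mkord.
apply: eq_bigr => j _.
by rewrite -(big_ord_widen e (fun=> 1%N) (ltn_ord j)) sum1_card card_ord.
Qed.

(** The matrix N of the map m^2 / m^3 -> Hom(m / m^2, m^3) given by
    multiplication is square, of size n = tau e. Its kernel consists of
    elements of m^2 killed by m, that is of the socle m^3; so N is invertible. *)
Lemma mul_surjective e n tau (x : 'I_e -> A) (w : 'I_n -> A) (z : 'I_tau -> A) :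
  socle m =i 'm^3 ->
  basis_mod ('m^1) ('m^2) x -> basis_mod ('m^2) ('m^3) w ->
  basis_mod ('m^3) ('m^4) z -> n = (tau * e)%N ->
  forall t : 'I_e -> A, (forall j, t j \in 'm^3) ->
  exists2 y, y \in 'm^2 & forall j, y * x j = t j.
Proof.
move=> soc hx hw hz nE t ht.
have [xU _] := hx; have [wU _] := hw; have [zU zbas] := hz.
have coord u : u \in 'm^3 -> exists c : 'rV[k]_tau, u = \sum_s c 0 s *: z s.
  move=> /zbas[c [hc _]]; exists c; apply/eqP; rewrite -subr_eq0.
  by move: hc; rewrite m4.
have [|G hG] := @choice _ _ (fun (l : 'I_n) (g : 'M[k]_(e, tau)) =>
    forall j, w l * x j = \sum_s g j s *: z s).
  move=> l; have [|g hg] := @choice _ _ (fun (j : 'I_e) (c : 'rV[k]_tau) =>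
      w l * x j = \sum_s c 0 s *: z s).
    by move=> j; apply: coord; apply: (ideal_exp_mul (wU l) (xU j)).
  by exists (\matrix_j g j) => j; rewrite hg; apply: eq_bigr => s _; rewrite mxE.
pose N := \matrix_l mxvec (G l).
have GE (c : 'rV[k]_n) j : (\sum_l c 0 l *: w l) * x j =
    \sum_s vec_mx (c *m N) j s *: z s.
  have -> : vec_mx (c *m N) = \sum_l c 0 l *: G l.
    rewrite mulmx_sum_row linear_sum; apply: eq_bigr => l _.
    by rewrite linearZ /= rowK mxvecK.
  rewrite mulr_suml; under [RHS]eq_bigr => s _ do rewrite summxE scaler_suml.
  rewrite exchange_big; apply: eq_bigr => l _ /=.
  rewrite -scalerAl hG scaler_sumr; apply: eq_bigr => s _.
  by rewrite mxE scalerA.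
have wc (c : 'rV[k]_n) : \sum_l c 0 l *: w l \in 'm^2.
  by apply: ideal_exp_sum => l _; apply: is_idealZ; first exact: ideal_expP.
(* An element of m^2 killing the x_j kills m, since m^2 m^2 = m^4 = 0. *)
have Nfree : row_free N.
  apply: inj_row_free => c cN.
  apply: (basis_mod_eq0 _ _ hw); try exact: ideal_expP.
  rewrite -soc; apply/asboolP => y hy.
  have {}hy : y \in 'm^1 by rewrite ideal_exp1.
  have [d [hd _]] := hx.2 _ hy.
  have := ideal_exp_mul (wc c) hd; rewrite m4 => /eqP.
  rewrite mulrBr => /eqP; rewrite subr_eq0 => /eqP ->.
  rewrite mulr_sumr big1 // => j _.
  rewrite -scalerAr GE cN linear0 big1 ?scaler0 // => s _.
  by rewrite mxE scale0r.
have Nfull : row_full N.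
  by rewrite /row_full (eqP Nfree) nE mulnC.
have [|T hT] := @choice _ _ (fun (j : 'I_e) (c : 'rV[k]_tau) =>
    t j = \sum_s c 0 s *: z s).
  by move=> j; apply: coord.
pose c := mxvec (\matrix_j T j) *m pinvmx N.
exists (\sum_l c 0 l *: w l) => // j.
rewrite GE mulmxKpV ?submx_full // mxvecK hT.
by apply: eq_bigr => s _; rewrite mxE.
Qed.

(** The correction y_i of x_i must absorb the m^3-part of x_i x_j symmetrically
    in i and j, which is why it takes half of it; the two halves come from
    y_i x_j and x_i y_j. *)
Lemma quadrics_of_lift e n (x : 'I_e -> A) (w : 'I_n -> A) :
  (2 : k) != 0 ->
  basis_mod ('m^1) ('m^2) x -> basis_mod ('m^2) ('m^3) w ->
  (forall t : 'I_e -> A, (forall j, t j \in 'm^3) ->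
    exists2 y, y \in 'm^2 & forall j, y * x j = t j) ->
  exists x' : 'I_e -> A, basis_mod ('m^1) ('m^2) x' /\
    forall i j, lin_span w (x' i * x' j).
Proof.
move=> two hx hw hlift.
have [xU _] := hx; have [wU wbas] := hw.
have xx i j : x i * x j \in 'm^2 by exact: (ideal_exp_mul (xU i) (xU j)).
(* pr is the projection to the span of w; u - pr u is the m^3-part of u. *)
have [|pr hpr] := @choice _ _ (fun u v => u \in 'm^2 ->
    lin_span w v /\ u - v \in 'm^3).
  move=> u; have [hu|_] := boolP (u \in 'm^2); last by exists 0.
  have [c [hc _]] := wbas _ hu; exists (\sum_i c 0 i *: w i).
  by split=> //; exists (c 0).
have [|y hy] := @choice _ _ (fun i y => y \in 'm^2 /\ forall j,
    y * x j = - (2^-1 *: (x i * x j - pr (x i * x j)))).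
  move=> i.
  have [|y y2 yE] := hlift (fun j => - (2^-1 *: (x i * x j - pr (x i * x j)))).
    move=> j; rewrite -scaleNr; apply: is_idealZ; first exact: ideal_expP.
    by case: (hpr _ (xx i j)).
  by exists y.
exists (fun i => x i + y i); split.
  apply: basis_mod_translate => //; try exact: ideal_expP.
    exact: ideal_expS.
  by move=> i; case: (hy i).
move=> i j.
have yy : y i * y j = 0.
  by have := ideal_exp_mul (hy i).1 (hy j).1; rewrite m4 => /eqP.
suff -> : (x i + y i) * (x j + y j) = pr (x i * x j) by case: (hpr _ (xx i j)).
rewrite mulrDl !mulrDr yy addr0 (hy i).2 [x i * y j]mulrC (hy j).2 [x j * x i]mulrC.
rewrite -addrA -opprD -scalerDl.
have -> : 2^-1 + 2^-1 = 1 :> k by rewrite -mulr2n -[_ *+ 2]mulr_natl divff.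
by rewrite scale1r subKr.
Qed.

End SocleDegreeThree.

Theorem theorem3p3 (k : closedFieldType) (char0 : [pchar k] =i pred0)
    (A : comAlgType k) (m : idealr A) (e n tau : nat)
    (A_artinian : artinian A)
    (A_local : is_local m)
    (A_residue : has_residue_field_k m)
    (A_socle_degree : socle_degree m 3)
    (A_level : level m 3 tau)
    (A_h_vector : h_vector m [:: 1%N; e; n; tau])
    (A_compressed : (n = minn (tau * e) 'C(e.+1, 2))%N) :
  exists f : {lrmorphism A -> gr m}, bijective f.
Proof.
have [_ m4] := A_socle_degree.
have [_ soc _] := A_level.
have [s [_ [sE] H]] := A_h_vector.
have {H}H j : (j <= 3)%N -> hilbert_function_at m j (nth 0%N [:: 1%N; e; n; tau] j).
  by move=> hj; apply: H; rewrite -sE.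
have [x hx] : exists x : 'I_e -> A, basis_mod (ideal_exp m 1) (ideal_exp m 2) x.
  exact: H 1%N isT.
have dim2 : dim_quot (ideal_exp m 2) (ideal_exp m 3) n by exact: H 2%N isT.
have [z hz] : exists z : 'I_tau -> A, basis_mod (ideal_exp m 3) (ideal_exp m 4) z.
  exact: H 3%N isT.
have I j : is_ideal (ideal_exp m j) by exact: ideal_expP.
move: A_compressed; rewrite /minn; case: ifP => _ nE.
  have [w hw] := dim2.
  have two : (2 : k) != 0 by rewrite ((pcharf0P k).1 char0).
  have [x' [hx' xx]] :=
    quadrics_of_lift m4 two hx hw (mul_surjective m4 soc hx hw hz nE).
  exact: (graded_of_quadrics m4 A_residue hx'
    (complement_basis (I 2%N) (I 3%N) hw) xx).
apply: (graded_of_quadrics m4 A_residue hx (W2 := lin_span (ordered_products x))).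
  apply: complement_spanning => //.
  - by rewrite card_ordered_pairs -nE.
  - by move=> p; apply: (ideal_exp_mul (hx.1 _) (hx.1 _)).
  - by move=> u; apply: ordered_products_span.
exact: ordered_products_mem.
Qed.
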